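(* Let $D>0$, $A\in\mathbb R$, $T>0$, let $u_0$ be a probability density on $\mathbb R$ with finite second moment, let $r>0$ be a fixed reference probability density on $\mathbb R$, and let $u(\cdot,t)$ be the solution to $$u_t+A\,u_x=D\,u_{xx}\quad (x\in\mathbb R,\ t\in(0,T]),\qquad u(\cdot,0)=u_0 .$$ Then, with $\widehat{\mathcal M}_{[0,T]}:=\{\widehat u(\cdot,t):t\in[0,T]\}$, $$d_2\big(\widehat{\mathcal M}_{[0,T]};L^2(dr)\big)\le\sqrt{2DT}.$$
   Context: The solution is $u(x,t)=(G_{Dt}*u_0)(x-At)$ for $t>0$ and $u(\cdot,0)=u_0$, where $G_s(x)=\frac{1}{\sqrt{4\pi s}}e^{-x^2/(4s)}$ is the heat kernel. CDT: for a probability density $w$ on $\mathbb R$ with finite second moment, $F_w(x)=\int_{-\infty}^xw(s)\,ds$, $F_w^\dagger(p)=\inf\{x\in\mathbb R:F_w(x)\ge p\}$ for $p\in(0,1)$, and the cumulative distribution transform (CDT) of $w$ with respect to $r$ is $\widehat w(\xi)=F_w^\dagger(F_r(\xi))$. For a time-dependent $u$, $\widehat u(\cdot,t)$ is the CDT of $u(\cdot,t)$. $L^2(dr)$ is the $L^2$ space on $\mathbb R$ with respect to the measure $r(\xi)\,d\xi$. Kolmogorov $n$-width: for a subset $\mathcal S$ of a Hilbert space $\mathcal H$, $d_n(\mathcal S;\mathcal H)=\inf_{V\subset\mathcal H,\ \dim V\le n}\ \sup_{w\in\mathcal S}\ \inf_{h\in V}\|w-h\|_{\mathcal H}$, the infimum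 being over linear subspaces $V$. *)

(* Defs.v *)
From HB Require Import structures.
From mathcomp Require Import all_boot all_order all_algebra.
From mathcomp Require Import all_classical all_reals all_analysis.
From mathcomp Require Import measurable_realfun.

Set Implicit Arguments.
Unset Strict Implicit.
Unset Printing Implicit Defensive.

Import Order.TTheory GRing.Theory Num.Theory.
Import numFieldNormedType.Exports.

Local Open Scope classical_set_scope.
Local Open Scope ring_scope.

Record density (R : realType) := Density {
  density_fun :> R -> R;
  density_measurable : measurable_fun setT density_fun;
  density_ge0 : forall x, 0 <= density_fun x;
  density_int1 : (\int[lebesgue_measure]_x (density_fun x)%:E = 1)%E }.

Definition second_moment (R : realType) (w : R -> R) : \bar R :=
  (\int[lebesgue_measure]_x (x ^+ 2 * w x)%:E)%E.

(* The measure w(x) dx. *)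
Definition density_measure (R : realType) (w : density R) : set R -> \bar R :=
  fun V => (\int[lebesgue_measure]_(x in V) (w x)%:E)%E.

Section density_measure_instances.
Context (R : realType) (w : density R).
Notation mu := (density_measure w).

Let mu0 : mu set0 = 0%E.
Proof. exact: integral_set0. Qed.

Let mu_ge0 A : (0 <= mu A)%E.
Proof. by apply: integral_ge0 => x _; rewrite lee_fin density_ge0. Qed.

Let mu_sigma_additive : semi_sigma_additive mu.
Proof.
move=> /= A mA tA mUA.
have mw : measurable_fun setT (EFin \o w).
  by apply/measurable_EFinP; exact: density_measurable.
rewrite /density_measure ge0_integral_bigcup//=; last 2 first.
- exact: measurable_funTS.
- by move=> x _; rewrite lee_fin density_ge0.
apply: is_cvg_ereal_nneg_natsum_cond => n _ _.
by apply: integral_ge0 => x _; rewrite lee_fin density_ge0.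
Qed.

HB.instance Definition _ :=
  isMeasure.Build _ _ _ mu mu0 mu_ge0 mu_sigma_additive.

Let mu_setT : mu setT = 1%E.
Proof. exact: density_int1. Qed.

HB.instance Definition _ := @Measure_isProbability.Build _ _ R mu mu_setT.

End density_measure_instances.

Definition heat_kernel (R : realType) (s x : R) : R :=
  (Num.sqrt (4 * pi * s))^-1 * expR (- x ^+ 2 / (4 * s)).

Definition convolution (R : realType) (f g : R -> R) (x : R) : R :=
  \int[lebesgue_measure]_y (f (x - y) * g y).

(* The solution u(x, t), t >= 0, of u_t + A u_x = D u_xx, u(., 0) = u0, by its
   representation formula; the heat kernel is singular at t = 0. *)
Definition advection_diffusion (R : realType) (D A : R) (u0 : R -> R)
    (x t : R) : R :=
  if 0 < t then convolution (heat_kernel (D * t)) u0 (x - A * t) else u0 x.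

Definition distribution_function (R : realType) (w : R -> R) (x : R) : R :=
  \int[lebesgue_measure]_(s in `]-oo, x]) w s.

(* Only meaningful for 0 < p < 1, where the set is nonempty and bounded below
   when w is a density. *)
Definition generalized_inverse (R : realType) (F : R -> R) (p : R) : R :=
  inf [set x | p <= F x].

Definition cdt (R : realType) (r w : R -> R) (xi : R) : R :=
  generalized_inverse (distribution_function w) (distribution_function r xi).

(* Square-integrable functions, without passing to classes modulo a.e. equality:
   the L^2 norm is a seminorm here.  Kolmogorov widths are unaffected, because
   every subspace of dimension at most n of the quotient is the image of a
   subspace of dimension at most n of this space, and conversely. *)
Definition L2 d (T : measurableType d) (R : realType)
    (mu : {measure set T -> \bar R}) := LfunType mu (lee1n 2).

Definition dim_le (R : realType) (H : lmodType R) (n : nat) (V : set H) : Prop :=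
  exists e : 'I_n -> H, V `<=`
    [set \sum_(i < n) c i *: e i | c in [set: 'I_n -> R]].

Definition kolmogorov_width d (T : measurableType d) (R : realType)
    (mu : {measure set T -> \bar R}) (n : nat) (S : set (L2 mu)) : \bar R :=
  ereal_inf [set ereal_sup [set ereal_inf
        [set 'N[mu]_2%:E[EFin \o (w - h)%R]%E | h in V] | w in S]
    | V in [set V : set (L2 mu) | submod_closed (mem V) /\ dim_le n V]].

(* The cumulative distribution transforms of u(., t), 0 <= t <= T, as elements of
   L^2(dr); by definition only those that are square integrable are kept. *)
Definition transformed_manifold (R : realType) (r : density R)
    (u : R -> R -> R) (T : R) : set (L2 (density_measure r)) :=
  [set f | exists2 t, 0 <= t <= T & (f : R -> R) = cdt r (u ^~ t)].
Arguments transformed_manifold {R} r u T.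

(* Main.v *)
From HB Require Import structures.
Require Import Defs.
From mathcomp Require Import all_boot all_order all_algebra.
From mathcomp Require Import all_classical all_reals all_analysis.
From mathcomp Require Import measurable_realfun.
From mathcomp Require Import ring lra.

Import Order.TTheory GRing.Theory Num.Theory.
Import numFieldNormedType.Exports.

Local Open Scope classical_set_scope.
Local Open Scope ring_scope.

(* Take V spanned by 1 and the CDT of u_0, and compare the CDT of u(., t) with
   that of u_0 shifted by A t.  Let X = y + A t and Y = X + z, where y has
   density u_0 and z is an independent centered normal variable of variance
   2 D t, so that Y has density u(., t).  Since F_r is uniform on (0, 1) under
   r dxi, both sides of the comparison are the quantile functions of X and Y at
   a common uniform variable.  This monotone coupling minimizes E (Y - X)^2
   among all couplings of the two laws, hence the squared distance is at most
   E z^2 = 2 D t <= 2 D T.  Minimality follows from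
     (x)_+^2 / 2 = int_0^oo (x - c)_+ dc,
     E (Y - X)_+ = int P (X <= a < Y) da,
   and P (X <= a < Y) >= F_X a - F_Y a, with equality for the monotone coupling
   when the right-hand side is nonnegative. *)

(** * Positive parts and their squares as integrals over thresholds *)

Lemma indic_iff (S T : Type) (R : pzRingType) (A : set S) (B : set T) x y :
  (A x <-> B y) -> \1_A x = \1_B y :> R.
Proof.
move=> AB; rewrite !indicE; congr (nat_of_bool _)%:R.
by apply/idP/idP; rewrite !in_setE => /AB.
Qed.

Lemma measurable_le_set d (T : measurableType d) (R : realType) (f g : T -> R) :
  measurable_fun setT f -> measurable_fun setT g ->
  measurable [set x | f x <= g x].
Proof.
move=> mf mg; have /(_ measurableT [set true]) := measurable_fun_ler mf mg.
by rewrite setTI; exact.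
Qed.

Lemma lebesgue_measure_between (R : realType) (u v : R) :
  (\int[@lebesgue_measure R]_a
     (\1_([set a | (u <= a)%R] `\` [set a | (v <= a)%R]) a)%:E =
   (Num.max 0 (v - u))%:E)%E.
Proof.
have -> : [set a | u <= a] `\` [set a | v <= a] = `[u, v[%classic.
  apply/seteqP; split => a /=; rewrite in_itv/= ltNge.
    by move=> [-> /negP].
  by move=> /andP[-> /negP].
rewrite integral_indic//= setIT lebesgue_measure_itv/= lte_fin.
case: ltP => uv; rewrite -?EFinB.
  by rewrite max_r// subr_ge0 ltW.
by rewrite max_l// subr_le0.
Qed.

(** Tonelli for the indicator of {(x, a) : X x <= a < Y x}: integrating over a first gives the
    length of [X x, Y x[, over x first a probability. *)
Lemma integral_pos_part d (T : measurableType d) (R : realType)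
    (P : probability T R) (X Y : T -> R) :
  measurable_fun setT X -> measurable_fun setT Y ->
  (\int[P]_x (Num.max 0 (Y x - X x))%:E =
   \int[@lebesgue_measure R]_a
     P ([set x | (X x <= a)%R] `\` [set x | (Y x <= a)%R]))%E.
Proof.
move=> mX mY.
pose GR := measurableTypeR R.
pose A := [set p : T * GR | X p.1 <= p.2] `\` [set p : T * GR | Y p.1 <= p.2].
have mA : measurable A.
  by apply: measurableD; apply: measurable_le_set => //;
    exact: measurableT_comp.
transitivity
  (\int[P]_x (\int[lebesgue_measure]_(a in [set: GR]) (\1_A (x, a))%:E))%E.
  apply: eq_integral => x _; rewrite -lebesgue_measure_between.
  by apply: eq_integral => a _; congr (_%:E); exact: indic_iff.
rewrite (fubini_tonelli (fun p : T * GR => (\1_A p)%:E))//=; last first.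
  exact/measurable_EFinP/measurable_indic.
apply: eq_integral => a _.
have mB : measurable ([set x | X x <= a] `\` [set x | Y x <= a]).
  by apply: measurableD; apply: measurable_le_set.
rewrite (_ : (fun x => _) = (fun x =>
    (\1_([set x | X x <= a] `\` [set x | Y x <= a]) x)%:E)); last first.
  by apply/funext => x; congr (_%:E); exact: indic_iff.
by rewrite integral_indic// setIT.
Qed.

Lemma FTC_is_derive (R : realType) (f F : R -> R) (a b : R) : a < b ->
  (forall x, is_derive x (1 : R) F (f x)) -> continuous f ->
  (\int[lebesgue_measure]_(x in `[a, b]) (f x)%:E = (F b)%:E - (F a)%:E)%E.
Proof.
move=> ab dF cf.
have cF : continuous F.
  move=> x; apply/differentiable_continuous/derivable1_diffP.
  exact: ex_derive.
apply: continuous_FTC2 => //; first exact: continuous_subspaceT.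
  split=> [x _| |]; first exact: ex_derive.
    exact/cvg_at_right_filter/cF.
  exact/cvg_at_left_filter/cF.
by move=> x _; rewrite derive1E; exact: derive_val.
Qed.

(** For h > 0 the integrand vanishes beyond h and has antiderivative h c - c^2 / 2 on [0, h]; for h
    <= 0 it vanishes on the whole half-line. *)
Lemma integral_hinge (R : realType) (h : R) :
  (\int[lebesgue_measure]_(c in `[0%R, +oo[) (Num.max 0 (h - c))%:E =
   (Num.max 0 h ^+ 2 / 2)%:E)%E.
Proof.
have mh : measurable_fun [set: R] (fun c => (Num.max 0 (h - c))%:E).
  apply/measurable_EFinP; apply: measurable_maxr => //.
  exact: measurable_funB.
have [h0|h0] := leP h 0.
  rewrite expr0n/= mul0r; apply: integral0_eq => c.
  rewrite /= in_itv/= andbT => c0; rewrite max_l//; lra.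

have <- : (`[0, h] `|` `]h, +oo[ = `[0, +oo[ :> set R)%classic.
  apply/seteqP; split => x /=; rewrite !in_itv/= ?andbT.
    by case=> [/andP[]//|]; lra.
  by move=> ->; case: leP; [left|right].
rewrite ge0_integral_setU//=; first last.
- apply/eqP; rewrite -subset0 => x /= [].
  by rewrite !in_itv/= andbT => /andP[_]; lra.
- by move=> c _; rewrite lee_fin le_max lexx.
- exact: measurable_funTS.
rewrite [X in (_ + X)%E]integral0_eq ?adde0; last first.
  move=> c; rewrite /= in_itv/= andbT => ch; rewrite max_l//; lra.
transitivity (\int[lebesgue_measure]_(c in `[0%R, h]) (h - c)%:E)%E.
  apply: eq_integral => c; rewrite inE/= in_itv/= => /andP[_ ch].
  by rewrite max_r// subr_ge0.
pose F (c : R) : R := h * c - c ^+ 2 / 2.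
have dF c : is_derive c (1 : R) F (h - c).
  apply: is_deriveB => //=.
    by apply: is_derive_eq; exact: mulr1.
  by apply: is_derive_eq; rewrite !scaler0 add0r /GRing.scale/=; field.
rewrite (@FTC_is_derive _ _ _ _ _ h0 dF).
  by rewrite /F expr0n/= mul0r mulr0 subrr sube0; congr (_%:E); field.
by move=> c; apply: cvgB; [exact: cvg_cst|exact: cvg_id].
Qed.

Lemma integral_pos_part_sqr d (T : measurableType d) (R : realType)
    (P : probability T R) (h : T -> R) :
  measurable_fun setT h ->
  (\int[P]_x (Num.max 0 (h x) ^+ 2 / 2)%:E =
   \int[@lebesgue_measure R]_(c in `[0%R, +oo[)
     \int[P]_x (Num.max 0 (h x - c))%:E)%E.
Proof.
move=> mh.
pose GR := measurableTypeR R.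
(* The indicator moves the domain of c into the integrand, so that Tonelli applies on the full
   product. *)
pose f (p : T * GR) : \bar R :=
  (Num.max 0 (h p.1 - p.2) * \1_`[0, +oo[ (p.2 : R))%:E.
have mf : measurable_fun setT f.
  apply/measurable_EFinP; apply: measurable_funM.
    apply: measurable_maxr => //; apply: measurable_funB => //.
    exact: measurableT_comp.
  exact: (@measurableT_comp _ _ _ _ _ _ (\1_`[0, +oo[ : R -> R)).
have f0 p : (0 <= f p)%E.
  by rewrite lee_fin mulr_ge0// ?le_max ?lexx// indicE.
transitivity (\int[P]_x \int[@lebesgue_measure R]_c f (x, c))%E.
  apply: eq_integral => x _; rewrite -integral_hinge integral_mkcond.
  apply: eq_integral => c _; rewrite /f/= indicE patchE.
  by case: ifPn; rewrite ?mulr1 ?mulr0.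
rewrite (fubini_tonelli f)// [RHS]integral_mkcond.
apply: eq_integral => c _; rewrite /f/= indicE patchE.
case: ifPn => _; first by under eq_integral do rewrite mulr1.
by under eq_integral do rewrite mulr0; rewrite integral0.
Qed.

(** * Optimality of the monotone coupling *)

(* The equivalences characterize X' and Y' as the quantile functions of X and Y
   evaluated at the uniform variable U. *)
Lemma quantile_coupling_pos_part_le d d' (T : measurableType d)
    (T' : measurableType d') (R : realType) (P : probability T R)
    (Q : probability T' R) (U : T -> R) (X' Y' : T -> R) (X Y : T' -> R) :
  measurable_fun setT X' -> measurable_fun setT Y' ->
  measurable_fun setT X -> measurable_fun setT Y ->
  (forall q, 0 <= q <= 1 -> P [set x | U x <= q] = q%:E) ->
  (forall x a, X' x <= a <-> U x <= fine (Q [set z | X z <= a])) ->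
  (forall x a, Y' x <= a <-> U x <= fine (Q [set z | Y z <= a])) ->
  (\int[P]_x (Num.max 0 (Y' x - X' x))%:E <=
   \int[Q]_z (Num.max 0 (Y z - X z))%:E)%E.
Proof.
move=> mX' mY' mX mY PU X'E Y'E.
(* As a function of a, this probability is a Tonelli marginal of the indicator of {f <= a < g},
   hence measurable. *)
have mpos e (S : measurableType e) (V : probability S R) (f g : S -> R) :
    measurable_fun setT f -> measurable_fun setT g ->
    measurable_fun [set: measurableTypeR R]
      (fun a => V ([set x | f x <= a] `\` [set x | g x <= a])).
  move=> mf mg.
  pose A := [set p : S * measurableTypeR R | f p.1 <= p.2] `\`
    [set p | g p.1 <= p.2].
  have mA : measurable A.
    by apply: measurableD; apply: measurable_le_set => //;
      exact: measurableT_comp.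
  apply: (eq_measurable_fun (fubini_G V (fun p => (\1_A p)%:E))) => [a _|].
    have mB : measurable ([set x | f x <= a] `\` [set x | g x <= a]).
      by apply: measurableD; exact: measurable_le_set.
    by rewrite -[X in _ = V X]setIT -integral_indic//; apply: eq_integral.
  apply: measurable_fun_fubini_tonelli_G => [|p]; last by rewrite lee_fin.
  exact/measurable_EFinP/measurable_indic.
rewrite !integral_pos_part//; apply: ge0_le_integral => //.
- exact: mpos.
- exact: mpos.
move=> a _.
have Xa : measurable [set z | X z <= a] by exact: measurable_le_set.
have Ya : measurable [set z | Y z <= a] by exact: measurable_le_set.
set p := fine (Q [set z | X z <= a]); set q := fine (Q [set z | Y z <= a]).
have pE : Q [set z | X z <= a] = p%:E by rewrite fineK// fin_num_measure.
have qE : Q [set z | Y z <= a] = q%:E by rewrite fineK// fin_num_measure.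
have -> : [set x | X' x <= a] = [set x | U x <= p].
  by apply/seteqP; split => x /X'E.
have -> : [set x | Y' x <= a] = [set x | U x <= q].
  by apply/seteqP; split => x /Y'E.
have p01 : 0 <= p <= 1 by rewrite -!lee_fin -pE measure_ge0 probability_le1.
have q01 : 0 <= q <= 1 by rewrite -!lee_fin -qE measure_ge0 probability_le1.
have [pq|qp] := leP p q.
  rewrite (_ : _ `\` _ = set0) ?measure0//.
  by rewrite -subset0 => x /= [Up] []; exact: le_trans Up pq.
have mUX : measurable [set x | U x <= p].
  rewrite (_ : [set x | U x <= p] = [set x | X' x <= a]).
    exact: measurable_le_set.
  by apply/seteqP; split => x /X'E.
have mUY : measurable [set x | U x <= q].
  rewrite (_ : [set x | U x <= q] = [set x | Y' x <= a]).
    exact: measurable_le_set.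
  by apply/seteqP; split => x /Y'E.
have -> : P ([set x | U x <= p] `\` [set x | U x <= q]) = (p%:E - q%:E)%E.
  rewrite measureD//; last by rewrite -ge0_fin_numE// fin_num_measure.
  rewrite setIidr; last by move=> x /= /le_trans; apply; exact: ltW.
  by congr (_ - _)%E; exact: PU.
(* What is removed from {X <= a} is its intersection with {Y <= a}, of probability at most q; hence
   the lower bound p - q. *)
rewrite -pE -qE measureD//; last by rewrite -ge0_fin_numE// fin_num_measure.
by apply: leeB => //; apply: le_measure; rewrite ?inE//; exact: measurableI.
Qed.

(** The square of x is twice the sum of the hinges (x)_+^2 / 2 and (-x)_+^2 / 2, and each hinge is
    an integral over c of positive parts. The inequality for positive parts applies for every c;
    exchanging the two variables handles the second hinge. *)
Lemma quantile_coupling_sqr_le d d' (T : measurableType d)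
    (T' : measurableType d') (R : realType) (P : probability T R)
    (Q : probability T' R) (U : T -> R) (X' Y' : T -> R) (X Y : T' -> R) :
  measurable_fun setT X' -> measurable_fun setT Y' ->
  measurable_fun setT X -> measurable_fun setT Y ->
  (forall q, 0 <= q <= 1 -> P [set x | U x <= q] = q%:E) ->
  (forall x a, X' x <= a <-> U x <= fine (Q [set z | X z <= a])) ->
  (forall x a, Y' x <= a <-> U x <= fine (Q [set z | Y z <= a])) ->
  (\int[P]_x ((Y' x - X' x) ^+ 2)%:E <= \int[Q]_z ((Y z - X z) ^+ 2)%:E)%E.
Proof.
move=> mX' mY' mX mY PU X'E Y'E.
pose hinge (x : R) : \bar R := (Num.max 0 x ^+ 2 / 2)%:E.
have hinge_le (V W : T -> R) (V' W' : T' -> R) :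
    measurable_fun setT V -> measurable_fun setT W ->
    measurable_fun setT V' -> measurable_fun setT W' ->
    (forall x a, V x <= a <-> U x <= fine (Q [set z | V' z <= a])) ->
    (forall x a, W x <= a <-> U x <= fine (Q [set z | W' z <= a])) ->
    (\int[P]_x hinge (W x - V x)%R <= \int[Q]_z hinge (W' z - V' z)%R)%E.
  move=> mV mW mV' mW' VE WE.
  have mB e (S : measurableType e) (f g : S -> R) :
      measurable_fun setT f -> measurable_fun setT g ->
      measurable_fun setT (fun x => f x - g x) by exact: measurable_funB.
  rewrite /hinge !integral_pos_part_sqr; [|exact: mB..].
  have mpos e (S : measurableType e) (M : probability S R) (f : S -> R) :
      measurable_fun setT f ->
      measurable_fun [set: measurableTypeR R] (fun c : measurableTypeR R =>
        \int[M]_x (Num.max 0 (f x - c)%R)%:E)%E.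
    move=> mf.
    apply: (measurable_fun_fubini_tonelli_G (m1 := M)
      (fun p : S * measurableTypeR R => (Num.max 0 (f p.1 - p.2))%:E)).
      apply/measurable_EFinP/measurable_maxr => //.
      apply: measurable_funB => //.
      exact: measurableT_comp.
    by move=> p; rewrite lee_fin le_max lexx.
  apply: ge0_le_integral => //.
  - by move=> c _; apply: integral_ge0 => x _; rewrite lee_fin le_max lexx.
  - by apply: measurable_funTS; apply: mpos; exact: mB.
  - by apply: measurable_funTS; apply: mpos; exact: mB.
  (* The threshold is absorbed by the second variable, W - V - c = (W - c) - V, and W - c is the
     quantile function of W' - c at [U]. *)
  move=> c _; under eq_integral do rewrite addrAC.
  under [leRHS]eq_integral do rewrite addrAC.
  apply: (@quantile_coupling_pos_part_le _ _ _ _ _ _ _ U V (fun x => W x - c)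
    V' (fun x => W' x - c)) => //; try exact: measurable_funB.
  move=> x a; rewrite lerBlDr.
  have -> : [set z | W' z - c <= a] = [set z | W' z <= a + c].
    by apply/eq_set => z; rewrite lerBlDr.
  exact: WE.
have split_sqr x : (x ^+ 2)%:E = (2%:E * (hinge x + hinge (- x)%R))%E.
  rewrite /hinge -EFinD -EFinM; congr (_%:E).
  by case: (leP 0 x) => ?; [rewrite (max_l _)|rewrite (max_r _)];
    rewrite ?expr0n/=; [field|lra|field|lra].
have mhinge e (S : measurableType e) (f : S -> R) :
    measurable_fun setT f -> measurable_fun setT (hinge \o f).
  move=> mf; apply/measurable_EFinP/measurable_funM => //.
  by apply: measurable_funX; exact: measurable_maxr.
have hinge_ge0 x : (0 <= hinge x)%E by rewrite lee_fin divr_ge0// sqr_ge0.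
have sqrE e (S : measurableType e) (M : probability S R) (f g : S -> R) :
    measurable_fun setT f -> measurable_fun setT g ->
    (\int[M]_x ((g x - f x) ^+ 2)%:E =
     2%:E * (\int[M]_x hinge (g x - f x)%R + \int[M]_x hinge (f x - g x)%R))%E.
  move=> mf mg; under eq_integral do rewrite split_sqr opprB.
  have mgf := mhinge _ _ _ (measurable_funB mg mf).
  have mfg := mhinge _ _ _ (measurable_funB mf mg).
  rewrite ge0_integralZl//; first by rewrite ge0_integralD.
  - exact: emeasurable_funD.
  - by move=> x _; exact: adde_ge0.
rewrite !sqrE//; apply: lee_wpmul2l => //.
by apply: leeD; exact: hinge_le.
Qed.

(** * Integration against a density *)

(** As f = (f - 0)_+, [integral_pos_part] turns the left side into an integral over a of the mass of
    {0 <= a < f}; Tonelli restores the integral over x, now weighted by [w]. *)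
Lemma ge0_integral_density_measure (R : realType) (w : density R) (f : R -> R) :
  measurable_fun setT f -> (forall x, 0 <= f x) ->
  (\int[density_measure w]_x (f x)%:E =
   \int[lebesgue_measure]_x (w x * f x)%:E)%E.
Proof.
move=> mf f0; pose GR := measurableTypeR R.
have fE x : f x = Num.max 0 (f x - 0) by rewrite subr0 max_r.
under eq_integral do rewrite fE.
rewrite integral_pos_part//.
pose A := [set p : GR * GR | 0 <= p.2] `\` [set p : GR * GR | f p.1 <= p.2].
have mA : measurable A.
  apply: measurableD; apply: (@measurable_le_set _ (GR * GR)%type) => //.
  exact: (@measurableT_comp _ _ _ _ _ _ (f : GR -> R)).
pose g (p : GR * GR) : \bar R := (w p.1 * \1_A p)%:E.
have mg : measurable_fun setT g.
  apply/measurable_EFinP/measurable_funM; last exact: measurable_indic.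
  apply: (@measurableT_comp _ _ _ _ _ _ (w : GR -> R)) => //.
  exact: density_measurable.
have g0 p : (0 <= g p)%E by rewrite lee_fin mulr_ge0// density_ge0.
transitivity
  (\int[@lebesgue_measure R]_a \int[@lebesgue_measure R]_x g (x, a))%E.
  congr (integral _ _ _); apply/funext => a.
  rewrite /= /density_measure integral_mkcond.
  apply: eq_integral => x _; rewrite patchE /g/=.
  rewrite (@indic_iff _ _ _ _ ([set x | 0 <= a] `\` [set x | f x <= a]) _ x)//.
  by rewrite indicE; case: ifPn; rewrite ?mulr1 ?mulr0.
rewrite -(fubini_tonelli g)//; apply: eq_integral => x _.
rewrite /g/=; under eq_integral do rewrite EFinM.
rewrite ge0_integralZl_EFin ?density_ge0//; last first.
  apply/measurable_EFinP.
  exact: (measurableT_comp (f := \1_A : GR * GR -> R)).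
by rewrite [f x]fE EFinM -lebesgue_measure_between; congr (_ * _)%E.
Qed.

(** * Generalized inverses of distribution functions *)

(** The limits at -oo and +oo make {x | p <= F x} bounded below and nonempty; right continuity puts
    its infimum into it. All later facts about quantile functions go through this Galois
    connection. *)
Lemma generalized_inverse_le (R : realType) (F : R -> R) (p a : R) :
  nondecreasing_fun F -> right_continuous F ->
  F x @[x --> -oo] --> (0 : R) -> F x @[x --> +oo] --> (1 : R) -> 0 < p < 1 ->
  generalized_inverse F p <= a <-> p <= F a.
Proof.
move=> ndF rcF F0 F1 /andP[p0 p1]; rewrite /generalized_inverse.
set S := [set x | p <= F x].
have S0 : S !=set0.
  have [M [_ FM]] := cvgr_gt _ F1 _ p1.
  by exists (M + 1); rewrite /S/= ltW// FM// ltrDl.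
have lS : has_lbound S.
  have [M [_ FM]] := cvgr_lt _ F0 _ p0.
  exists (M - 1) => x Sx; rewrite leNgt; apply/negP => xM.
  by move: Sx; rewrite /S/= leNgt FM// (lt_trans xM)// ltrBlDr ltrDl.
split=> [ia|pFa]; last exact: ge_inf.
(* If F (inf S) < p, right continuity gives F < p slightly to the right of inf S, where, or at inf S
   itself, there is a point of S: a contradiction. *)
apply: le_trans (ndF _ _ ia); rewrite leNgt; apply/negP => Fip.
have : \forall x \near (inf S)^'+, F x < p by exact: cvgr_lt (rcF _) _ Fip.
move=> [e /= e0 He].
have [y Sy yi] := inf_adherent e0 (conj S0 lS).
have iy : inf S <= y by exact: ge_inf.
move: iy; rewrite le_eqVlt => /predU1P[iy|iy].
  by move: Sy; rewrite /S/= leNgt -iy Fip.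
have : F y < p.
  apply: He => //=; rewrite ltr0_norm ?subr_lt0// opprB ltrBlDl//.
by rewrite ltNge; move: Sy; rewrite /S/= => ->.
Qed.

Lemma generalized_inverse_cdf_le d (T : measurableType d) (R : realType)
    (Q : probability T R) (X : T -> R) (p a : R) :
  measurable_fun setT X -> 0 < p < 1 ->
  generalized_inverse (fun b => fine (Q [set z | X z <= b])) p <= a <->
  p <= fine (Q [set z | X z <= a]).
Proof.
move=> mX.
pose X' : {RV Q >-> R} := HB.pack X (isMeasurableFun.Build _ _ _ _ X mX).
have -> : (fun b => fine (Q [set z | X z <= b])) = fine \o cdf X'.
  apply/funext => b /=; rewrite /cdf /distribution /pushforward/=.
  by congr (fine (Q _)); apply/seteqP; split => z; rewrite /= in_itv.
have -> : fine (Q [set z | X z <= a]) = fine (cdf X' a).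
  rewrite /cdf /distribution /pushforward/=.
  by congr (fine (Q _)); apply/seteqP; split => z; rewrite /= in_itv.
apply: generalized_inverse_le.
- by move=> x y xy; rewrite /= fine_le ?fin_num_measure// cdf_nondecreasing.
- move=> x; apply: fine_cvg.
  by rewrite fineK ?fin_num_measure//; exact: cdf_right_continuous.
- exact/fine_cvg/cvg_cdfNy0.
- exact/fine_cvg/cvg_cdfy1.
Qed.

Lemma distribution_functionE (R : realType) (w : density R) :
  distribution_function w = fun x => fine (density_measure w [set z | z <= x]).
Proof. by apply/funext => x; rewrite -set_itvNyc. Qed.

(** * Uniformity of the reference distribution function *)

Section positive_density.
Variables (R : realType) (r : density R).
Hypothesis r_gt0 : forall x, 0 < r x.
Notation P := (density_measure r).
Notation F := (distribution_function r).

Lemma density_measure_le x : P [set z | z <= x] = (F x)%:E.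
Proof.
rewrite distribution_functionE fineK// fin_num_measure//.
by rewrite -set_itvNyc; exact: measurable_itv.
Qed.

(** If the mass were zero, [r] would vanish almost everywhere on the interval, and the interval
    would be Lebesgue null. *)
Lemma density_measure_itv_gt0 x y : x < y -> (0 < P `]x, y])%E.
Proof.
move=> xy; rewrite lt0e measure_ge0 andbT; apply/eqP => P0.
have mr : measurable_fun `]x, y]%classic (EFin \o r).
  by apply/measurable_funTS/measurable_EFinP; exact: density_measurable.
have /ae_eq_integral_abs :
    (\int[lebesgue_measure]_(z in `]x, y]) `|(EFin \o r) z| = 0)%E.
  rewrite -[RHS]P0; apply: eq_integral => z _.
  by rewrite /= ger0_norm// density_ge0.
move=> /(_ (measurable_itv _) mr) [N [mN N0 subN]].
have : (lebesgue_measure `]x, y]%classic <= @lebesgue_measure R N)%E.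
  apply: le_measure; rewrite ?inE//.
  apply: subset_trans subN => z zxy /= /(_ zxy) /eqP.
  by rewrite eqe gt_eqF.
rewrite [X in (_ <= X)%E](_ : _ = 0%E)// lebesgue_measure_itv/= lte_fin xy.
by rewrite -EFinB lee_fin leNgt subr_gt0 xy.
Qed.

Lemma distribution_function_increasing x y : x < y -> F x < F y.
Proof.
move=> xy; rewrite -lte_fin -!density_measure_le.
have -> : [set z | z <= y] = [set z | z <= x] `|` `]x, y]%classic.
  apply/seteqP; split => z /=; rewrite in_itv/=.
    by move=> ->; rewrite andbT; case: leP; [left|right].
  by case=> [zx|/andP[]//]; rewrite (le_trans zx)// ltW.
have -> : P ([set z | z <= x] `|` `]x, y]%classic) = ((F x)%:E + P `]x, y])%E.
  rewrite measureU//; first by congr (_ + _)%E; exact: density_measure_le.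
    by rewrite -set_itvNyc; exact: measurable_itv.
  rewrite -subset0 => z /= []; rewrite in_itv/= => zx /andP[].
  by rewrite ltNge zx.
by rewrite density_measure_le lteDl// density_measure_itv_gt0.
Qed.

(** Keeps F within the open interval on which generalized inverses are meaningful. *)
Lemma distribution_function_gt0_lt1 x : 0 < F x < 1.
Proof.
have F01 y : 0 <= F y <= 1.
  rewrite -!lee_fin -density_measure_le measure_ge0 probability_le1//.
  by rewrite -set_itvNyc; exact: measurable_itv.
have x1 : x - 1 < x by rewrite ltrBlDr ltrDl.
have x2 : x < x + 1 by rewrite ltrDl.
have /andP[F0 _] := F01 (x - 1); have /andP[_ F1] := F01 (x + 1).
by rewrite (le_lt_trans F0) ?(lt_le_trans _ F1)//;
  exact: distribution_function_increasing.
Qed.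

(** The quantile x0 of q satisfies F x0 = q because points have mass zero; strict monotonicity then
    turns {F <= q} into the half-line up to x0. *)
Lemma distribution_function_uniform q : 0 <= q <= 1 ->
  P [set x | F x <= q] = q%:E.
Proof.
(* The quantile characterization excludes q = 0 and q = 1; there the set is empty, respectively
   everything, since 0 < F < 1. *)
move=> /andP[]; rewrite le_eqVlt => /predU1P[<- _|q0].
  rewrite (_ : [set x | _] = set0) ?measure0//.
  by rewrite -subset0 => x /=; have := distribution_function_gt0_lt1 x; lra.
rewrite le_eqVlt => /predU1P[->|q1].
  rewrite (_ : [set x | _] = setT) ?probability_setT//.
  by rewrite -subTset => x /= _; have := distribution_function_gt0_lt1 x; lra.
pose x0 := generalized_inverse F q.
have Fx a : x0 <= a <-> q <= F a.
  rewrite /x0 distribution_functionE.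
  by apply: (@generalized_inverse_cdf_le _ _ _ P id) => //; rewrite q0.
have Fx0 : F x0 = q.
  apply/eqP; rewrite eq_le (Fx x0).1// andbT -lee_fin -density_measure_le.
  (* The half-line up to x0 is the increasing union of these, each of mass below q, together with
     the null point x0. *)
  pose G i := [set z | z <= x0 - i.+1%:R^-1].
  have mG i : measurable (G i) by rewrite /G -set_itvNyc; exact: measurable_itv.
  have mUG : measurable (\bigcup_i G i) by exact: bigcup_measurable.
  have -> : [set z | z <= x0] = (\bigcup_i G i) `|` [set x0].
    apply/seteqP; split => z /=.
      rewrite le_eqVlt => /predU1P[->|]; first by right.
      rewrite -subr_gt0 => /ltr_add_invr[k]; rewrite add0r => zk; left.
      by exists k => //; rewrite /G/= lerBrDr -lerBrDl ltW.
    case=> [[k _]|->//]; rewrite /G/= => /le_trans; apply.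
    by rewrite lerBlDr lerDl invr_ge0.
  apply: le_trans (measureU2 _ mUG (measurable_set1 x0)) _.
  rewrite [X in (_ + X)%E](_ : _ = 0%E) ?adde0; last first.
    apply: null_set_integral => //; last exact: lebesgue_measure_set1.
    by apply/measurable_funTS/measurable_EFinP; exact: density_measurable.
  have ndG : nondecreasing_seq G.
    move=> m n mn; apply/subsetPset => z; rewrite /G/= => /le_trans; apply.
    by rewrite lerB// lef_pV2 ?posrE// ler_nat.
  have cG := nondecreasing_cvg_mu (mu := P) mG mUG ndG.
  suff : (limn (P \o G) <= q%:E)%E by rewrite (cvg_lim _ cG).
  apply: lime_le; first exact: cvgP cG.
  apply: nearW => n; rewrite /= density_measure_le lee_fin ltW// ltNge.
  by apply/negP => /Fx; rewrite leNgt ltrBlDr ltrDl invr_gt0 ltr0n.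
have -> : [set x | F x <= q] = [set x | x <= x0].
  apply/seteqP; split => x /=; rewrite -Fx0.
    by rewrite !leNgt; apply: contra => /distribution_function_increasing.
  rewrite le_eqVlt => /predU1P[->//|/distribution_function_increasing/ltW//].
by rewrite density_measure_le Fx0.
Qed.
End positive_density.

(** * Centered normal laws and the heat kernel *)

(** The law of the independent noise z, used with sigma^2 = 2 D t. *)
Definition centered_normal {R : realType} (sigma : R) : density R :=
  Density (measurable_normal_pdf 0 sigma) (normal_pdf_ge0 0 sigma)
    (integral_normal_pdf 0 sigma).

Lemma normal_pdf_center (R : realType) (m sigma x : R) : sigma != 0 ->
  normal_pdf m sigma x = normal_pdf 0 sigma (x - m).
Proof. by move=> s0; rewrite !normal_pdfE// /normal_fun subr0. Qed.

(** Matching exponents gives 2 sigma^2 = 4 s; the variance 2 s is the origin of the factor 2 in the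
    final bound. *)
Lemma heat_kernel_normal_pdf (R : realType) (s x : R) : 0 < s ->
  heat_kernel s x = normal_pdf 0 (Num.sqrt (2 * s)) x.
Proof.
move=> s0; rewrite normal_pdfE ?gt_eqF ?sqrtr_gt0 ?mulr_gt0//.
rewrite /heat_kernel /normal_peak /normal_fun sqr_sqrtr ?mulr_ge0 ?(ltW s0)//.
rewrite subr0; congr ((Num.sqrt _)^-1 * expR _).
  by rewrite -mulr_natl; ring.
by congr (_ / _); rewrite -mulr_natl; ring.
Qed.

(** Since g' = - x g / sigma^2, the function - sigma^2 x g has derivative x^2 g - sigma^2 g. Its
    increment over a symmetric interval is nonpositive, so the truncated second moment is at most
    sigma^2 times the truncated mass; monotone convergence removes the truncation. *)
Lemma normal_second_moment_le (R : realType) (sigma : R) : sigma != 0 ->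
  (second_moment (centered_normal sigma) <= (sigma ^+ 2)%:E)%E.
Proof.
move=> s0; have s2 : 0 < sigma ^+ 2 by rewrite exprn_even_gt0.
pose g := normal_pdf 0 sigma.
have cg : continuous g by exact: continuous_normal_pdf.
have gE x : g x = normal_peak sigma * expR (- x ^+ 2 / (sigma ^+ 2 *+ 2)).
  by rewrite /g normal_pdfE// /normal_fun subr0.
have dg (x : R) : is_derive x (1 : R) g (- x / sigma ^+ 2 * g x).
  rewrite (_ : g = fun x => normal_peak sigma *
      expR (- x ^+ 2 / (sigma ^+ 2 *+ 2))); last first.
    exact/funext.
  by apply: is_derive_eq; rewrite /GRing.scale/=; field.
pose G (x : R) : R := - sigma ^+ 2 * (x * g x).
have dG (x : R) : is_derive x (1 : R) G (x ^+ 2 * g x - sigma ^+ 2 * g x).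
  rewrite /G; apply: is_derive_eq; rewrite /GRing.scale/=; field.
  exact: s0.
have mx2g : measurable_fun [set: R] (fun x => (x ^+ 2 * g x)%:E).
  apply/measurable_EFinP/measurable_funM; last exact: measurable_normal_pdf.
  exact: measurable_funX.
pose I (n : nat) : set R := `[- n.+1%:R, n.+1%:R]%classic.
have bound n : (\int[lebesgue_measure]_(x in I n) (x ^+ 2 * g x)%:E
    <= (sigma ^+ 2)%:E)%E.
  have n0 : - n.+1%:R < n.+1%:R :> R by rewrite gtrN.
  have cx2 : continuous (fun x : R => x ^+ 2 * g x).
    by move=> x; apply: cvgM; [exact: sqr_continuous|exact: cg].
  have csg : continuous (fun x : R => sigma ^+ 2 * g x).
    by move=> x; apply: cvgM; [exact: cvg_cst|exact: cg].
  have cf : continuous (fun x : R => x ^+ 2 * g x - sigma ^+ 2 * g x).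
    by move=> x; apply: cvgB; [exact: cx2|exact: csg].
  have int (f : R -> R) : continuous f ->
      (@lebesgue_measure R).-integrable (I n) (EFin \o f).
    move=> cf'; apply: continuous_compact_integrable.
      exact: segment_compact.
    exact: continuous_subspaceT.
  have FTC := FTC_is_derive _ _ _ _ _ n0 dG cf.
  have -> : (\int[lebesgue_measure]_(x in I n) (x ^+ 2 * g x)%:E =
    \int[lebesgue_measure]_(x in I n)
    ((x ^+ 2 * g x - sigma ^+ 2 * g x)%:E + (sigma ^+ 2 * g x)%:E))%E.
    by apply: eq_integral => x _; rewrite -EFinD subrK.
  have mI : measurable (I n : set (measurableTypeR R)) by exact: measurable_itv.
  rewrite (integralD _ (int _ cf) (int _ csg))//.
  rewrite FTC -[leRHS]add0e; apply: leeD.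
    (* As g is even, the boundary term is - 2 sigma^2 b g(b) with b = n + 1, and its sign gives the
       bound. *)
    have gN : g (- n.+1%:R) = g n.+1%:R by rewrite !gE sqrrN.
    rewrite -EFinB lee_fin /G gN.
    have : 0 <= sigma ^+ 2 * (n.+1%:R * g n.+1%:R).
      by rewrite mulr_ge0 ?(ltW s2)// mulr_ge0// normal_pdf_ge0.
    lra.
  under eq_integral do rewrite /= EFinM.
  rewrite ge0_integralZl_EFin ?(ltW s2)//; last 2 first.
  - by move=> x _; rewrite lee_fin normal_pdf_ge0.
  - by apply/measurable_funTS/measurable_EFinP; exact: measurable_normal_pdf.
  rewrite -[leRHS]mule1; apply: lee_wpmul2l; first by rewrite lee_fin ltW.
  rewrite -(integral_normal_pdf 0 sigma); apply: ge0_subset_integral => //.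
  - by apply/measurable_EFinP; exact: measurable_normal_pdf.
  - by move=> x _; rewrite lee_fin normal_pdf_ge0.
have UE : \bigcup_n I n = [set: R].
  rewrite -subTset => x _; exists (Num.truncn `|x|) => //=.
  by rewrite /I/= in_itv/= -ler_norml ltW// truncnS_gt.
have cv : (\int[lebesgue_measure]_(x in I n) (x ^+ 2 * g x)%:E @[n --> \oo] -->
    \int[lebesgue_measure]_x (x ^+ 2 * g x)%:E)%E.
  rewrite -[X in _ --> integral _ X _]UE.
  apply: (@ge0_nondecreasing_set_cvg_integral _ (measurableTypeR R) R I
      (fun x => (x ^+ 2 * g x)%:E) lebesgue_measure).
  - move=> m k mk; apply/subsetPset => x; rewrite /I/= !in_itv/= -!ler_norml.
    by move=> /le_trans; apply; rewrite ler_nat.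
  - by move=> k; exact: measurable_itv.
  - by move=> k; exact: measurable_funTS.
  - by move=> k x _; rewrite lee_fin mulr_ge0 ?sqr_ge0 ?normal_pdf_ge0.
have : (limn (fun n => \int[lebesgue_measure]_(x in I n) (x ^+ 2 * g x)%:E) <=
    (sigma ^+ 2)%:E)%E.
  apply: lime_le; first exact: cvgP cv.
  by apply: nearW => k; exact: bound.
by rewrite (cvg_lim _ cv).
Qed.

(** Change of variables x -> x + m. Half-lines suffice because the law of the solution enters only
    through its distribution function. *)
Lemma normal_pdf_shift (R : realType) (m sigma b : R) : sigma != 0 ->
  (\int[lebesgue_measure]_(x in `]-oo, b]) (normal_pdf m sigma x)%:E =
   \int[lebesgue_measure]_(x in `]-oo, (b - m)%R]) (normal_pdf 0 sigma x)%:E)%E.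
Proof.
move=> s0; pose F (x : R) : R := x + m.
have dF (x : R) : is_derive x (1 : R) F 1.
  by rewrite /F; apply: is_derive_eq; rewrite addr0.
have F'E : (F^`())%classic = cst 1.
  by apply/funext => x; rewrite derive1E; exact: derive_val.
have {1}-> : b = F (b - m) by rewrite /F subrK.
rewrite increasing_ge0_integration_by_substitutionNy//.
- apply: eq_integral => x _; rewrite F'E mulr1.
  by rewrite /= normal_pdf_center// /F addrK.
- by move=> x y _ _; rewrite /F ltrD2r.
- by move=> x _; rewrite F'E; exact: cst_continuous.
- by rewrite F'E; exact: is_cvg_cst.
- by rewrite F'E; exact: cvg_cst.
- split; first by move=> x _; exact: ex_derive.
  by apply/cvg_at_left_filter; apply: cvgD; [exact: cvg_id|exact: cvg_cst].
- exact: cvg_addrr_Ny.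
- exact/continuous_subspaceT/continuous_normal_pdf.
- by move=> x _; exact: normal_pdf_ge0.
Qed.

(** * The solution as the law of a sum *)

(** Regrouping x - A t - y as x - (y + A t) centers the kernel at y + A t. The convolution is a
    real-valued integral, so lifting it to the extended reals requires finiteness: the normal
    density is bounded by its peak and [u0] has mass 1. *)
Lemma advection_diffusion_normal (R : realType) (D A t x : R) (u0 : density R) :
  0 < D -> 0 < t ->
  ((advection_diffusion D A u0 x t)%:E =
   \int[lebesgue_measure]_y
     (u0 y * normal_pdf (y + A * t) (Num.sqrt (2 * (D * t))) x)%:E)%E.
Proof.
move=> D0 t0; set s := Num.sqrt _.
have Dt0 : 0 < D * t by rewrite mulr_gt0.
have s0 : s != 0 by rewrite gt_eqF// sqrtr_gt0 mulr_gt0.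
rewrite /advection_diffusion t0 /convolution /Rintegral.
have -> : (\int[lebesgue_measure]_y
      (heat_kernel (D * t) (x - A * t - y) * u0 y)%:E =
    \int[lebesgue_measure]_y (u0 y * normal_pdf (y + A * t) s x)%:E)%E.
  apply: eq_integral => y _.
  rewrite heat_kernel_normal_pdf// mulrC (@normal_pdf_center _ (y + _))//.
  by rewrite opprD addrA addrAC.
have mu0 := density_measurable u0.
have mpdf : measurable_fun [set: R] (fun y => normal_pdf (y + A * t) s x).
  under eq_fun do rewrite normal_pdf_center//.
  apply: (measurableT_comp (measurable_normal_pdf 0 s)) => //.
  by apply: measurable_funB => //; exact: measurable_funD.
rewrite fineK// ge0_fin_numE; last first.
  apply: integral_ge0 => y _.
  by rewrite lee_fin mulr_ge0 ?density_ge0 ?normal_pdf_ge0.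
apply: (@le_lt_trans _ _
  (\int[lebesgue_measure]_y ((normal_peak s)%:E * (u0 y)%:E))%E).
  apply: ge0_le_integral => //.
  - by move=> y _; rewrite lee_fin mulr_ge0 ?density_ge0 ?normal_pdf_ge0.
  - by apply/measurable_EFinP/measurable_funM.
  - by apply/measurable_EFinP/measurable_funM.
  - move=> y _; rewrite -EFinM lee_fin mulrC ler_wpM2r ?density_ge0//.
    exact: normal_pdf_ub.
rewrite ge0_integralZl_EFin ?normal_peak_ge0//.
- by rewrite density_int1 mule1 ltry.
- by move=> y _; rewrite lee_fin density_ge0.
- exact/measurable_EFinP.
Qed.

(** Tonelli, with the position x integrated first: for fixed y this gives the normal mass below b -
    (y + A t), which is the mass of the section at y of the event on the right. *)
Lemma distribution_function_advection_diffusion (R : realType) (D A t : R)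
    (u0 : density R) : 0 < D -> 0 < t ->
  distribution_function (advection_diffusion D A u0 ^~ t) =
  fun b => fine ((density_measure u0 \x
    density_measure (centered_normal (Num.sqrt (2 * (D * t)))))%E
      [set z | z.1 + A * t + z.2 <= b]).
Proof.
move=> D0 t0; apply/funext => b; set s := Num.sqrt _.
have s0 : s != 0 by rewrite gt_eqF// sqrtr_gt0 !mulr_gt0.
pose GR := measurableTypeR R.
pose g (p : GR * GR) : \bar R :=
  (\1_(`]-oo, b]%classic : set GR) p.1 *
   (u0 p.2 * normal_pdf (p.2 + A * t) s p.1))%:E.
have mg : measurable_fun setT g.
  apply/measurable_EFinP; apply: measurable_funM.
    have m1 : measurable_fun [set: GR]
        (\1_(`]-oo, b]%classic : set GR) : GR -> R).
      exact: measurable_indic.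
    exact: (measurableT_comp m1 measurable_fst).
  apply: measurable_funM.
    apply: (@measurableT_comp _ _ _ _ _ _ (u0 : GR -> R)) => //.
    exact: density_measurable.
  under eq_fun do rewrite normal_pdf_center//.
  apply: (@measurableT_comp _ _ _ _ _ _ (normal_pdf 0 s : R -> R)).
    exact: measurable_normal_pdf.
  apply: measurable_funB; first exact: (@measurable_fst _ _ GR GR).
  by apply: measurable_funD => //; exact: (@measurable_snd _ _ GR GR).
have g0 p : (0 <= g p)%E.
  by rewrite lee_fin !mulr_ge0 ?density_ge0 ?normal_pdf_ge0// indicE.
rewrite /distribution_function /Rintegral; congr fine.
transitivity
  (\int[@lebesgue_measure R]_x \int[@lebesgue_measure R]_y g (x, y))%E.
  rewrite integral_mkcond; apply: eq_integral => x _.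
  rewrite patchE /g/= indicE; case: ifPn => _.
    rewrite advection_diffusion_normal//.
    by apply: eq_integral => y _; rewrite mul1r.
  by under eq_integral do rewrite mul0r; rewrite integral0.
rewrite (fubini_tonelli g)//.
transitivity (\int[density_measure u0]_y
    (fine (density_measure (centered_normal s)
       [set z | z <= b - (y + A * t)]))%:E)%E.
  rewrite ge0_integral_density_measure//.
  - apply: eq_integral => y _; rewrite EFinM fineK; last first.
      by rewrite fin_num_measure// -set_itvNyc; exact: measurable_itv.
    rewrite -set_itvNyc /density_measure/= -normal_pdf_shift//.
    rewrite -ge0_integralZl_EFin ?density_ge0//; last 2 first.
    + by move=> x _; rewrite lee_fin normal_pdf_ge0.
    + by apply/measurable_funTS/measurable_EFinP; exact: measurable_normal_pdf.
    rewrite [RHS]integral_mkcond; apply: eq_integral => x _.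
    rewrite patchE /g/= indicE; case: ifPn => _; first by rewrite mul1r EFinM.
    by rewrite mul0r.
  (* A larger y lowers the threshold b - (y + A t), so the mass is monotone in y. *)
  - apply: nonincreasing_measurable => // y z yz.
    have ms c : measurable [set x : R | x <= c].
      by rewrite -set_itvNyc; exact: measurable_itv.
    apply: fine_le; rewrite ?fin_num_measure//.
    apply: le_measure; rewrite ?inE// => x /= /le_trans; apply.
    by rewrite lerB// lerD2r.
  - by move=> y; exact: fine_ge0.
rewrite /product_measure1; apply: eq_integral => y _.
rewrite fineK/=; last first.
  by rewrite fin_num_measure// -set_itvNyc; exact: measurable_itv.
congr (density_measure _ _); apply/seteqP.
by split => z; rewrite /xsection/= inE/=; lra.
Qed.

(** * L^2 norms from integrals of squares *)

Lemma Lnorm2_le d (T : measurableType d) (R : realType)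
    (mu : {measure set T -> \bar R}) (f : T -> R) (c : R) : 0 <= c ->
  (\int[mu]_x (f x ^+ 2)%:E <= (c ^+ 2)%:E)%E ->
  ('N[mu]_2%:E[EFin \o f] <= c%:E)%E.
Proof.
move=> c0 fc; rewrite unlock.
have -> : (\int[mu]_x (`|(EFin \o f) x| `^ 2%:R) = \int[mu]_x (f x ^+ 2)%:E)%E.
  apply: eq_integral => x _.
  by rewrite /comp abse_EFin poweR_EFin powR_mulrn// real_normK ?num_real.
have -> : c%:E = ((c ^+ 2)%:E `^ 2^-1)%E.
  by rewrite poweR_EFin -powR_mulrn// -powRrM divff// powRr1.
apply: gt0_ler_poweR => //; rewrite ?in_itv/= ?leey ?andbT.
- by apply: integral_ge0 => x _; rewrite lee_fin sqr_ge0.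
- by rewrite lee_fin sqr_ge0.
Qed.

Lemma Lfun2_sqr d (T : measurableType d) (R : realType)
    (mu : {measure set T -> \bar R}) (f : T -> R) : measurable_fun setT f ->
  (\int[mu]_x (f x ^+ 2)%:E < +oo)%E -> f \in Lfun mu 2%:E.
Proof.
move=> mf fy; rewrite inE; apply/andP; split; rewrite inE//=.
have f0 : (0 <= \int[mu]_x (f x ^+ 2)%:E)%E.
  by apply: integral_ge0 => x _; rewrite lee_fin sqr_ge0.
set c := fine (\int[mu]_x (f x ^+ 2)%:E).
apply: le_lt_trans (ltry (Num.sqrt c)); apply: Lnorm2_le; rewrite ?sqrtr_ge0//.
by rewrite sqr_sqrtr ?fine_ge0// fineK// ge0_fin_numE.
Qed.

(** * CDTs as a monotone coupling *)

Section cdt_coupling.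
Variables (R : realType) (r : density R).
Hypothesis r_gt0 : forall x, 0 < r x.
Notation P := (density_measure r).
Notation F := (distribution_function r).

Section cdt_of_law.
Context d (T : measurableType d) (Q : probability T R).
Variables (X : T -> R) (w : R -> R).
Hypothesis mX : measurable_fun setT X.
Hypothesis wE : distribution_function w = fun b => fine (Q [set z | X z <= b]).

(** Supplies the equivalences of the coupling lemmas, with [F] as the uniform variable. As [w] is
    tied to the law of [X] only through its distribution function, the solution at time t is covered
    without being packaged as a [density]. *)
Lemma cdt_le x a : cdt r w x <= a <-> F x <= fine (Q [set z | X z <= a]).
Proof.
rewrite /cdt wE; apply: generalized_inverse_cdf_le => //.
exact: distribution_function_gt0_lt1.
Qed.

Lemma measurable_cdt : measurable_fun setT (cdt r w).
Proof.
apply: nondecreasing_measurable => // x y xy; apply/cdt_le.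
apply: (@le_trans _ _ (F y)); last exact/cdt_le.
move: xy; rewrite le_eqVlt => /predU1P[->//|xy].
exact/ltW/distribution_function_increasing.
Qed.

End cdt_of_law.

(** The coupling inequality with the constant 0 as first variable on both sides. *)
Lemma integral_cdt_sqr_le (w : density R) :
  (\int[P]_x (cdt r w x ^+ 2)%:E <= second_moment w)%E.
Proof.
have wE : distribution_function w =
    fun b => fine (density_measure w [set z | id z <= b]).
  exact: distribution_functionE.
have mid : measurable_fun [set: R] (@id R) by exact: measurable_id.
have -> : second_moment w = (\int[density_measure w]_x ((x - 0) ^+ 2)%:E)%E.
  rewrite ge0_integral_density_measure; last by move=> x; exact: sqr_ge0.
    by apply: eq_integral => x _; rewrite subr0 mulrC.
  by apply: measurable_funX; exact: measurable_funB.
under eq_integral do rewrite -[X in (X ^+ 2)%:E]subr0.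
apply: (@quantile_coupling_sqr_le _ _ _ _ _ _ _ F
  (cst 0) (cdt r w) (cst 0) id) => //.
- exact: (@measurable_cdt _ _ (density_measure w) id w mid wE).
- exact: distribution_function_uniform.
- move=> x a /=.
  have /andP[F0 F1] := distribution_function_gt0_lt1 _ _ r_gt0 x.
  (* The constant 0 has distribution function 1 for a >= 0 and 0 for a < 0; as 0 < F < 1, it is its
     own quantile function. *)
  have [a0|a0] := leP 0 a.
    rewrite (_ : [set _ | _] = setT); last by apply/seteqP; split.
    by rewrite probability_setT/= ltW.
  rewrite (_ : [set _ | _] = set0); last by apply/seteqP; split.
  by rewrite measure0/= leNgt F0.
- exact: (@cdt_le _ _ (density_measure w) id w mid wE).
Qed.

Lemma advection_diffusion0 (D A : R) (u0 : R -> R) :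
  advection_diffusion D A u0 ^~ 0 = u0.
Proof. by apply/funext => x; rewrite /advection_diffusion ltxx. Qed.

Lemma measurable_cdt_density (w : density R) : measurable_fun setT (cdt r w).
Proof.
exact: (@measurable_cdt _ _ (density_measure w) id).
Qed.

Lemma cdt_advection_diffusion (D A t : R) (u0 : density R) :
  0 < D -> 0 <= t ->
  measurable_fun setT (cdt r (advection_diffusion D A u0 ^~ t)) /\
  (\int[P]_x ((cdt r (advection_diffusion D A u0 ^~ t) x -
     (cdt r u0 x + A * t)) ^+ 2)%:E <= (2 * D * t)%:E)%E.
Proof.
(* At t = 0 the solution is [u0] by definition and the difference vanishes; the normal
   representation covers t > 0. *)
move=> D0; rewrite le_eqVlt => /predU1P[<-|t0].
  rewrite advection_diffusion0 !mulr0; split.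
    exact: measurable_cdt_density.
  by under eq_integral do rewrite addr0 subrr expr0n; rewrite integral0.
pose s := Num.sqrt (2 * (D * t)).
have s0 : s != 0 by rewrite gt_eqF// sqrtr_gt0 !mulr_gt0.
pose g := centered_normal s.
pose Q : probability _ R := (density_measure u0 \x density_measure g)%E.
pose X (z : R * R) : R := z.1 + A * t.
pose Y (z : R * R) : R := z.1 + A * t + z.2.
have mX : measurable_fun setT X by apply: measurable_funD.
have mY : measurable_fun setT Y by apply: measurable_funD.
have YE : distribution_function (advection_diffusion D A u0 ^~ t) =
    fun b => fine (Q [set z | Y z <= b]).
  exact: distribution_function_advection_diffusion.
have m1 : measurable_fun [set: R * R] (@fst R R) by exact: measurable_fst.
(* The first marginal of [Q] is the law of [u0], so the CDT of [u0] is the quantile function of the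
   first coordinate. *)
have u0E : distribution_function u0 = fun b => fine (Q [set z | z.1 <= b]).
  rewrite distribution_functionE; apply/funext => b; congr fine.
  rewrite (_ : [set z : R * R | z.1 <= b] = [set z | z <= b] `*` setT);
    last first.
    by apply/seteqP; split => z //= [].
  have mb : measurable [set z : R | z <= b].
    by rewrite -set_itvNyc; exact: measurable_itv.
  rewrite /Q/= product_measure1E// [X in (_ * X)%E](_ : _ = 1%E) ?mule1//.
  exact: density_int1.
split; first exact: (@measurable_cdt _ _ Q Y _ mY YE).
apply: (@le_trans _ _ (\int[Q]_z ((Y z - X z) ^+ 2)%:E)%E).
  apply: (@quantile_coupling_sqr_le _ _ _ _ _ _ _ F
    (fun x => cdt r u0 x + A * t) _ X Y) => //.
  - by apply: measurable_funD => //; exact: measurable_cdt_density.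
  - exact: (@measurable_cdt _ _ Q Y _ mY YE).
  - exact: distribution_function_uniform.
  - move=> x a; rewrite -lerBrDr.
    have -> : [set z | X z <= a] = [set z | z.1 <= a - A * t].
      by apply/eq_set => z; rewrite /X lerBrDr.
    exact: (@cdt_le _ _ Q fst _ m1 u0E).
  - exact: (@cdt_le _ _ Q Y _ mY YE).
(* Y - X = z involves the second coordinate alone, so the inner integral is the same constant for
   every y. *)
rewrite /X /Y; under eq_integral do rewrite addrAC subrr add0r.
rewrite (fubini_tonelli1 (fun z : R * R => (z.2 ^+ 2)%:E))//; last 2 first.
- by apply/measurable_EFinP/measurable_funX.
- by move=> z; rewrite lee_fin sqr_ge0.
pose c := (\int[density_measure g]_z (z ^+ 2)%:E)%E.
have -> : (\int[density_measure u0]_y fubini_F (density_measure g)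
      (fun z : R * R => (z.2 ^+ 2)%:E) y = c)%E.
  transitivity (\int[density_measure u0]_y cst c y)%E; first exact: eq_integral.
  rewrite integral_cst// [X in (_ * X)%E](_ : _ = 1%E) ?mule1//.
  exact: density_int1.
rewrite /c ge0_integral_density_measure;
  [|exact: measurable_funX|by move=> z; exact: sqr_ge0].
rewrite (_ : 2 * D * t = s ^+ 2); last first.
  by rewrite sqr_sqrtr ?mulrA// !mulr_ge0 ?ltW.
apply: le_trans (normal_second_moment_le _ _ s0).
by under eq_integral do rewrite mulrC.
Qed.

End cdt_coupling.

(** * Square-integrable CDTs and the width bound *)

(** The CDT is the sum of three square-integrable functions: its distance to the shifted CDT of
    [u0], that CDT itself, controlled by the second moment, and the constant A t. *)
Lemma cdt_advection_diffusion_Lfun (R : realType) (D A t : R) (u0 r : density R)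
    (r_gt0 : forall x, 0 < r x) :
  (second_moment u0 < +oo)%E -> 0 < D -> 0 <= t ->
  cdt r (advection_diffusion D A u0 ^~ t) \in Lfun (density_measure r) 2%:E.
Proof.
move=> u0_moment D_gt0 t0.
have [mut dist] := @cdt_advection_diffusion _ _ r_gt0 D A t u0 D_gt0 t0.
have mu0 := @measurable_cdt_density _ _ r_gt0 u0.
have mh : measurable_fun setT (fun x => cdt r u0 x + A * t).
  by apply: measurable_funD.
have L0 : cdt r u0 \in Lfun (density_measure r) 2%:E.
  apply: Lfun2_sqr => //; apply: le_lt_trans u0_moment.
  exact: integral_cdt_sqr_le.
pose dist_t x :=
  cdt r (advection_diffusion D A u0 ^~ t) x - (cdt r u0 x + A * t).
have Ld : dist_t \in Lfun (density_measure r) 2%:E.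
  apply: Lfun2_sqr; first exact: measurable_funB.
  by apply: le_lt_trans dist _; exact: ltry.
have -> : cdt r (advection_diffusion D A u0 ^~ t) =
    dist_t + (cdt r u0 + cst (A * t)).
  by apply/funext => x; rewrite !fctE subrK.
have [_ addL] := Lfun_addr_closed (density_measure r) (lee1n 2).
exact: (addL _ _ Ld (addL _ _ L0 (Lfun_cst _ _ _))).
Qed.

Lemma span_submod_closed (R : realType) (H : lmodType R) n (e : 'I_n -> H) :
  submod_closed (mem [set \sum_(i < n) c i *: e i | c in [set: 'I_n -> R]]).
Proof.
split.
  rewrite inE; exists (fun=> 0) => //.
  by rewrite big1// => i _; rewrite scale0r.
move=> a u v; rewrite !inE => -[c _ <-] [c' _ <-].
exists (fun i => a * c i + c' i) => //.
rewrite scaler_sumr -big_split/=; apply: eq_bigr => i _.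
by rewrite scalerDl scalerA.
Qed.

(* The first conjunct says that every CDT of u(., t) lies in L^2(dr), so that
   the width in the second one is that of the whole transformed manifold. *)
Theorem theorem5p1 (R : realType) (D A T : R) (u0 r : density R)
    (D_gt0 : 0 < D) (T_gt0 : 0 < T)
    (u0_moment : (second_moment u0 < +oo)%E)
    (r_gt0 : forall x, 0 < r x) :
  (forall t, 0 <= t <= T ->
     cdt r (advection_diffusion D A u0 ^~ t) \in Lfun (density_measure r) 2%:E) /\
  (kolmogorov_width 2 (transformed_manifold r (advection_diffusion D A u0) T)
     <= (Num.sqrt (2 * D * T))%:E)%E.
Proof.
split=> [t /andP[t0 _]|]; first exact: cdt_advection_diffusion_Lfun.
have L0 : cdt r u0 \in Lfun (density_measure r) 2%:E.
  have := @cdt_advection_diffusion_Lfun _ D A 0 u0 r r_gt0 u0_moment D_gt0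
    (lexx _).
  by rewrite advection_diffusion0.
pose e0 : L2 (density_measure r) := Lfun_Sub (lee1n 2) L0.
pose e1 : L2 (density_measure r) :=
  Lfun_Sub (lee1n 2) (Lfun_cst (density_measure r) 1 2).
pose e (i : 'I_2) := if i == ord0 then e0 else e1.
pose V := [set \sum_(i < 2) c i *: e i | c in [set: 'I_2 -> R]].
apply: (@le_trans _ _ (ereal_sup [set ereal_inf
        [set 'N[density_measure r]_2%:E[EFin \o (w - h)%R]%E | h in V] |
   w in transformed_manifold r (advection_diffusion D A u0) T])).
  apply: ereal_inf_lbound; exists V => //; split.
    exact: span_submod_closed.
  by exists e.
apply: ub_ereal_sup => _ [w [t /andP[t0 tT] wE] <-].
(* Translation by A t adds the constant A t to a CDT, so advection stays inside [V] and only
   diffusion contributes to the distance. *)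
pose h : L2 (density_measure r) := e0 + (A * t) *: e1.
apply: (@le_trans _ _ ('N[density_measure r]_2%:E[EFin \o (w - h)%R]%E)).
  apply: ereal_inf_lbound; exists h => //.
  exists (fun i : 'I_2 => if i == ord0 then 1 else A * t) => //.
  by rewrite big_ord_recl big_ord1 /e/= scale1r.
apply: Lnorm2_le; first exact: sqrtr_ge0.
have [_ dist] := @cdt_advection_diffusion _ _ r_gt0 D A t u0 D_gt0 t0.
rewrite sqr_sqrtr; last by rewrite !mulr_ge0 ?ltW.
apply: (@le_trans _ _ (2 * D * t)%:E).
  apply: le_trans dist; rewrite le_eqVlt; apply/orP; left; apply/eqP.
  apply: eq_integral => x _; congr (_ ^+ 2)%:E.
  rewrite (_ : (w - h) x = w x - (e0 x + A * t * e1 x))//.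
  by rewrite wE [e1 x](_ : _ = 1)// mulr1.
by rewrite lee_fin ler_wpM2l// mulr_ge0// ltW.
Qed.
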